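(* For any dynamical system $(X,\mathbb{Z})$ on a compact metric space $X$ one has $\operatorname{mdim}(X\times_{\mathbb{Z}}\mathbb{R})=\operatorname{mdim}X$, where $X\times_{\mathbb{Z}}\mathbb{R}$ is Borel's construction (the mapping torus) for $(X,\mathbb{Z})$, considered with its natural $\mathbb{Z}$-action.
   Context: A dynamical system $(X,\mathbb{Z})$ is an action of $\mathbb{Z}$ on $X$ by homeomorphisms; the action of $z\in\mathbb{Z}$ on $x\in X$ is written $x+z$. Borel's construction: let $\mathbb{Z}$ act on $X\times\mathbb{R}$ by $(x,t)+z=(x+z,t+z)$, $z\in\mathbb{Z}$. Then $X\times_{\mathbb{Z}}\mathbb{R}$ is the orbit space $(X\times\mathbb{R})/\mathbb{Z}$, which is a compact metrizable space. The action $(x,t)+r=(x,t+r)$, $r\in\mathbb{R}$, of $\mathbb{R}$ on $X\times\mathbb{R}$ induces an action of $\mathbb{R}$ on $X\times_{\mathbb{Z}}\mathbb{R}$, and $\mathbb{Z}$ acts on $X\times_{\mathbb{Z}}\mathbb{R}$ as a subgroup of $\mathbb{R}$; $\operatorname{mdim}(X\times_{\mathbb{Z}}\mathbb{R})$ is the mean dimension of this $\mathbb{Z}$-action. Mean dimension: let $\mathbb{Z}$ act on a compact metric space $Y$. For a collection $\mathcal{A}$ of subsets of $Y$ and $z\in\mathbb{Z}$ let $\mathcal{A}+z=\{A+z : A\in\mathcal{A}\}$, where $A+z=\{y+z : y\in A\}$; $\operatorname{mesh}\mathcal{A}$ is the supremum of the diameters of the elements of $\mathcal{A}$; $\operatorname{ord}\mathcal{A}$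 is the maximal number of elements of $\mathcal{A}$ having a common point. For a real number $d>0$ write $\operatorname{mdim}Y\le d^-$ if for every $\epsilon>0$ there is a finite closed cover $\mathcal{A}$ of $Y$ such that $\operatorname{mesh}(\mathcal{A}+z)<\epsilon$ for every integer $z$ satisfying $0\le zd<\operatorname{ord}\mathcal{A}$. Then $\operatorname{mdim}Y=\inf\{d>0 : \operatorname{mdim}Y\le d^-\}$, with $\operatorname{mdim}Y=\infty$ if this set is empty. This coincides with Gromov's mean dimension and does not depend on the choice of a compatible metric on $Y$. *)

(* Defs.v *)
From HB Require Import structures.
From mathcomp Require Import all_boot all_order all_algebra generic_quotient.
From mathcomp Require Import finmap.
From mathcomp Require Import all_classical all_reals all_analysis.

Set Implicit Arguments.
Unset Strict Implicit.
Unset Printing Implicit Defensive.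

Import Order.TTheory GRing.Theory Num.Theory.
Import numFieldNormedType.Exports.

Local Open Scope classical_set_scope.
Local Open Scope ring_scope.
Local Open Scope quotient_scope.

(* Each map [act^~ g] is a homeomorphism, with inverse [act^~ (- g)]. *)
Record action (G : zmodType) (Y : topologicalType) := Action {
  act :> Y -> G -> Y ;
  act0 : forall y, act y 0 = y ;
  actD : forall y g h, act y (g + h) = act (act y g) h ;
  act_continuous : forall g, continuous (act^~ g)
}.

Section orbit_space.
Context {G : zmodType} {Y : topologicalType}.
Variable b : action G Y.

Definition orbit_rel : rel Y := fun y y' => `[< exists g, y' = b y g >].

Lemma orbit_rel_refl : reflexive orbit_rel.
Proof. by move=> y; apply/asboolP; exists 0; rewrite act0. Qed.

Lemma orbit_rel_sym : symmetric orbit_rel.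
Proof.
suff H y y' : orbit_rel y y' -> orbit_rel y' y by move=> y y'; apply/idP/idP; exact: H.
by move=> /asboolP[g ->]; apply/asboolP; exists (- g); rewrite -actD subrr act0.
Qed.

Lemma orbit_rel_trans : transitive orbit_rel.
Proof.
move=> y2 y1 y3 /asboolP[g ->] /asboolP[h ->].
by apply/asboolP; exists (g + h); rewrite actD.
Qed.

Definition orbit_equiv : equiv_rel Y :=
  EquivRel orbit_rel orbit_rel_refl orbit_rel_sym orbit_rel_trans.

Definition orbit_space : topologicalType :=
  quotient_topology {eq_quot orbit_equiv}.

Definition orbit_of : Y -> orbit_space := \pi_{eq_quot orbit_equiv}.

Definition orbit_repr : orbit_space -> Y := @repr _ {eq_quot orbit_equiv}.

Lemma orbit_reprK y : orbit_of (orbit_repr y) = y.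
Proof. exact: (@reprK _ {eq_quot orbit_equiv}). Qed.

Lemma orbit_of_eqP y y' : orbit_of y = orbit_of y' <-> exists g, y' = b y g.
Proof.
split=> [/eqquotP/asboolP //|H].
by apply/eqquotP/asboolP.
Qed.

Lemma orbit_of_continuous : continuous orbit_of.
Proof. exact: (@pi_continuous _ {eq_quot orbit_equiv}). Qed.

Lemma orbit_space_continuous (Z : topologicalType) (f : orbit_space -> Z) :
  continuous (f \o orbit_of) -> continuous f.
Proof. by move=> ?; apply/(@quotient_continuous _ {eq_quot orbit_equiv}). Qed.

End orbit_space.

Section borel.
Context {R : realType} {X : topologicalType}.
Variable a : action int X.

Definition diag_map (p : X * R) (z : int) : X * R := (a p.1 z, p.2 + z%:~R).

Lemma diag_map0 p : diag_map p 0 = p.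
Proof. by case: p => x t; rewrite /diag_map /= act0 addr0. Qed.

Lemma diag_mapD p z w : diag_map p (z + w) = diag_map (diag_map p z) w.
Proof. by rewrite /diag_map /= actD rmorphD addrA. Qed.

Lemma diag_map_continuous z : continuous (diag_map^~ z).
Proof.
move=> p; rewrite /diag_map.
have c1 : {for p, continuous (fun p : X * R => a p.1 z)}.
  apply: (@continuous_comp _ _ _ fst (a^~ z)); first exact: cvg_fst.
  exact: act_continuous.
have c2 : {for p, continuous (fun p : X * R => p.2 + z%:~R)}.
  by apply: cvgD; [exact: cvg_snd | exact: cvg_cst].
exact: (cvg_pair c1 c2).
Qed.

Definition diag_action : action int (X * R)%type :=
  Action diag_map0 diag_mapD diag_map_continuous.

Definition borel : topologicalType := orbit_space diag_action.

Definition flow_map (y : borel) (r : R) : borel :=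
  let p := orbit_repr y in orbit_of diag_action (p.1, p.2 + r).

Lemma flow_mapE p r : flow_map (orbit_of diag_action p) r =
  orbit_of diag_action (p.1, p.2 + r).
Proof.
have [z /= E] : exists z, p = diag_action (orbit_repr (orbit_of diag_action p)) z.
  by apply/orbit_of_eqP; rewrite orbit_reprK.
by apply/orbit_of_eqP; exists z; rewrite {1 2}E /= /diag_map /= addrAC.
Qed.

Lemma flow_map0 y : flow_map y 0 = y.
Proof. by rewrite -(orbit_reprK y) flow_mapE addr0 -surjective_pairing. Qed.

Lemma flow_mapD y r s : flow_map y (r + s) = flow_map (flow_map y r) s.
Proof. by rewrite -(orbit_reprK y) !flow_mapE addrA. Qed.

Lemma flow_map_continuous r : continuous (flow_map^~ r).
Proof.
apply: orbit_space_continuous.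
rewrite (_ : _ \o _ = orbit_of diag_action \o (fun p => (p.1, p.2 + r))); last first.
  by apply/funext => p /=; rewrite flow_mapE.
move=> p; apply: continuous_comp; last exact: orbit_of_continuous.
have c2 : {for p, continuous (fun p : X * R => p.2 + r)}.
  by apply: cvgD; [exact: cvg_snd | exact: cvg_cst].
exact: (cvg_pair cvg_fst c2).
Qed.

Definition borel_flow : action R borel := Action flow_map0 flow_mapD flow_map_continuous.

Lemma borel_flowE x t r : borel_flow (orbit_of diag_action (x, t)) r =
  orbit_of diag_action (x, t + r).
Proof. exact: flow_mapE. Qed.

End borel.

Arguments borel R {X} a.
Arguments borel_flow R {X} a.

Section restriction.
Context {R : realType} {Y : topologicalType}.
Variable b : action R Y.

Definition int_map (y : Y) (z : int) : Y := b y z%:~R.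

Lemma int_map0 y : int_map y 0 = y. Proof. exact: act0. Qed.

Lemma int_mapD y z w : int_map y (z + w) = int_map (int_map y z) w.
Proof. by rewrite /int_map rmorphD actD. Qed.

Lemma int_map_continuous z : continuous (int_map^~ z).
Proof. exact: act_continuous. Qed.

Definition int_action : action int Y := Action int_map0 int_mapD int_map_continuous.

End restriction.

Definition borel_action (R : realType) (X : topologicalType)
    (a : action int X) : action int (borel R a) :=
  int_action (borel_flow R a).

Arguments borel_action R {X} a.

Section mean_dimension.
Context {R : realType}.

Definition compatible_metric (Y : topologicalType) (rho : Y -> Y -> R) : Prop :=
  [/\ forall x, rho x x = 0,
      forall x y, rho x y = 0 -> x = y,
      forall x y, rho x y = rho y x,
      forall x y z, rho x z <= rho x y + rho y z &
      forall x, nbhs x =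
        filter_from [set e : R | 0 < e] (fun e => [set y | rho x y < e])].

Lemma mdist_compatible (Y : metricType R) : compatible_metric (@mdist R Y).
Proof.
split; [exact: mdistxx | exact: mdist_positivity | exact: metric_sym | |].
  exact: metric_triangle.
by move=> x; rewrite -metricType_numDomainType.filter_from_mdist_nbhs.
Qed.

(* [0] is inserted so that the empty set and the empty collection, whose
   supremum in [\bar R] would be [-oo], have diameter and mesh [0]. *)
Definition diam (Y : Type) (rho : Y -> Y -> R) (A : set Y) : \bar R :=
  ereal_sup (0%E |` [set (rho x y)%:E | x in A & y in A]).

Definition mesh (Y : Type) (rho : Y -> Y -> R) (C : set (set Y)) : \bar R :=
  ereal_sup (0%E |` [set diam rho A | A in C]).

(* Meaningful for finite [C] only: [fset_set C] is empty when [C] is infinite.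
   On an empty space [ord C = 0]. *)
Definition ord (Y : Type) (C : set (set Y)) : nat :=
  \max_(B <- fpowerset (fset_set C) |
        `[< \bigcap_(A in [set` B]) A !=set0 >]) #|` B|.

Definition translate (Y : topologicalType) (b : action int Y)
    (C : set (set Y)) (z : int) : set (set Y) :=
  [set [set b y z | y in A] | A in C].

Definition mdim_le_minus (Y : topologicalType) (rho : Y -> Y -> R)
    (b : action int Y) (d : R) : Prop :=
  forall eps : R, 0 < eps -> exists C : set (set Y),
    [/\ finite_set C,
        forall A, C A -> closed A,
        \bigcup_(A in C) A = setT &
        forall z : int, 0 <= z%:~R * d < (ord C)%:R ->
          (mesh rho (translate b C z) < eps%:E)%E].

Definition mdim (Y : topologicalType) (rho : Y -> Y -> R) (b : action int Y) :
    \bar R :=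
  ereal_inf [set d%:E | d in [set d | 0 < d /\ mdim_le_minus rho b d]].

End mean_dimension.

(* Main.v *)
(* The fibre of X x_Z R over 0 is a copy of X on which the integer z acts as
   the translation by -z.  Reversing time does not change mdim, as one sees by
   translating a cover, and restricting covers to this fibre gives
   mdim X <= mdim (X x_Z R).

   Conversely, let a cover of X of order n be small for all times up to K, with
   n <= d K for some d close to mdim X, and let phi_i be functions equal to 1 on
   its members and supported near them, so that at most n of them are nonzero
   at a point.  On X x R consider, for integers r = p M + j with 0 <= j < M, the
   functions
     Phi_{r,i}(x, t) = phi_i(x - j K - p) bump(M t - r),
   where bump is 1 on [1/2, M + 1/2] and 0 outside (0, M + 1).  The diagonal
   action of Z only shifts the index r by M, and at most (M + 1) n of the
   functions are nonzero at a point.  Cutting at the (M + 1) n levels between 0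
   and 1, and recording for each level which functions lie above it, yields that
   many disjoint families of closed sets; they descend to X x_Z R and cover it.
   At every point each residue j has an index r whose bump is 1, hence some
   Phi_{r,i} that is 1 and lies above every level.  So the members of the cover
   are small for M K units of time, whereas the order is at most
   (M + 1) n <= (1 + 1 / M) d M K. *)

Require Import Defs.
From mathcomp Require Import all_boot all_order all_algebra.
From mathcomp Require Import finmap ring lra zify.
From mathcomp Require Import all_classical all_reals all_analysis.

Set Implicit Arguments.
Unset Strict Implicit.
Unset Printing Implicit Defensive.

Import Order.TTheory GRing.Theory Num.Theory.
Import numFieldNormedType.Exports.

Local Open Scope classical_set_scope.
Local Open Scope ring_scope.

(** * Order of finite covers and of their preimages *)

Section order_of_covers.

Lemma ord_ub (Y : Type) (C : set (set Y)) (m : nat) : finite_set C ->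
  (forall (B : {fset set Y}) (y : Y), (forall A, A \in B -> C A /\ A y) ->
     (#|` B| <= m)%N) -> (ord C <= m)%N.
Proof.
move=> fC H; apply/bigmax_leqP_seq => B; rewrite fpowersetE => BC /asboolP[y yB].
apply: (H B y) => A AB; split; last exact: yB.
by have := fsubsetP BC _ AB; rewrite in_fset_set// inE.
Qed.

Lemma ord_lb (Y : Type) (C : set (set Y)) (B : {fset set Y}) (y : Y) :
  finite_set C -> (forall A, A \in B -> C A /\ A y) -> (#|` B| <= ord C)%N.
Proof.
move=> fC H; apply: (@leq_bigmax_seq _ _ _ (fun B : {fset set Y} => #|` B|) B).
  rewrite fpowersetE; apply/fsubsetP => A /H[CA _].
  by rewrite in_fset_set// inE.
by apply/asboolP; exists y => A /H[].
Qed.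

(** Members sharing a point lie in different families, so choosing a family for each of them is
    injective. *)
Lemma ord_disjoint_families (Y : Type) (C : set (set Y)) (m : nat)
    (F : 'I_m -> set (set Y)) : finite_set C ->
  (forall A, C A -> exists k, F k A) ->
  (forall k A B y, F k A -> F k B -> A y -> B y -> A = B) -> (ord C <= m)%N.
Proof.
move=> fC CF Fdisj; apply: ord_ub => // B y By.
have /choice[f fP] (A : B) : exists k, F k (val A).
  by apply: CF; have [] := By _ (valP A).
rewrite cardfE -[leqRHS]card_ord; apply: (@leq_card _ _ f) => A A' ff.
apply: val_inj; apply: (Fdisj (f A) _ _ y) => //; first by rewrite ff.
- by have [] := By _ (valP A).
- by have [] := By _ (valP A').
Qed.

Definition pullback (Y Z : Type) (g : Y -> Z) (C : set (set Z)) : set (set Y) :=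
  [set g @^-1` A | A in C].

(** Distinct preimages through [y] come from distinct members of [C] through [g y]. Preimages may
    coincide, hence only an inequality. *)
Lemma ord_pullback (Y Z : Type) (g : Y -> Z) (C : set (set Z)) :
  finite_set C -> (ord (pullback g C) <= ord C)%N.
Proof.
move=> fC; apply: ord_ub; first exact: finite_image.
move=> B y By.
have /choice[f fP] (A : set Y) : exists A', A \in B -> C A' /\ A = g @^-1` A'.
  case: (pselect (A \in B)) => [/[dup] AB /By[[A' CA' <-] _]|nAB]; first by exists A'.
  by exists set0 => /nAB.
have /card_in_imfsetP/eqP <- : {in B &, injective f}.
  by move=> A A' /fP[_ {2}->] /fP[_ {2}->] ->.
apply: (@ord_lb _ _ _ (g y)) => // A' /imfsetP[A /= AB ->].
have [CfA AE] := fP _ AB; split => //.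
by have [_] := By _ AB; rewrite {1}AE.
Qed.

Lemma pullback_closed_cover (Y Z : topologicalType) (g : Y -> Z)
    (C : set (set Z)) : continuous g ->
  finite_set C -> (forall A, C A -> closed A) -> \bigcup_(A in C) A = setT ->
  [/\ finite_set (pullback g C), forall A, pullback g C A -> closed A &
      \bigcup_(A in pullback g C) A = setT].
Proof.
move=> cg fC clC CT; split; first exact: finite_image.
  by move=> _ [A CA <-]; apply: closed_comp => [y _|]; [exact: cg|exact: clC].
rewrite -subTset => y _.
have [A CA Agy] : (\bigcup_(A in C) A) (g y) by rewrite CT.
by exists (g @^-1` A) => //; exists A.
Qed.

End order_of_covers.

(** * Passing between mesh bounds and pointwise distances *)

Section mesh.
Context {R : realType} {Y : topologicalType} (rho : Y -> Y -> R).
Variable b : action int Y.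

Lemma lt_mesh_translate (C : set (set Y)) (z : int) (eps : R) A x y :
  (mesh rho (translate b C z) < eps%:E)%E -> C A -> A x -> A y ->
  rho (b x z) (b y z) < eps.
Proof.
move=> Ceps CA Ax Ay; rewrite -lte_fin; apply: le_lt_trans Ceps.
apply: (@le_trans _ _ (diam rho [set b y z | y in A])).
  apply: ereal_sup_ubound; right; exists (b x z); first by exists x.
  by exists (b y z) => //; exists y.
apply: ereal_sup_ubound; right; exists [set b y z | y in A] => //.
by exists A.
Qed.

Lemma mesh_translate_le (C : set (set Y)) (z : int) (eps : R) : 0 <= eps ->
  (forall A x y, C A -> A x -> A y -> rho (b x z) (b y z) <= eps) ->
  (mesh rho (translate b C z) <= eps%:E)%E.
Proof.
move=> e0 H; apply: ge_ereal_sup => _ [->|[_ [A CA <-] <-]]; first by rewrite lee_fin.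
apply: ge_ereal_sup => _ [->|[_ [x Ax <-] [_ [y Ay <-] <-]]]; rewrite lee_fin//.
exact: H CA Ax Ay.
Qed.

End mesh.

(** * Compatible metrics and uniform estimates from compactness *)

Section compatible_metrics.
Context {R : realType}.

Section one_metric.
Context {Z : topologicalType} (sigma : Z -> Z -> R).
Hypothesis sigma_compatible : compatible_metric sigma.

Lemma compatible_nbhs x e : 0 < e -> nbhs x [set y | sigma x y < e].
Proof. by case: sigma_compatible => _ _ _ _ -> e0; exists e. Qed.

Lemma compatible_ge0 x y : 0 <= sigma x y.
Proof.
case: sigma_compatible => s0 _ ssym stri _.
by have := stri x y x; rewrite s0 [sigma y x]ssym; lra.
Qed.

Lemma compatible_hausdorff : hausdorff_space Z.
Proof.
case: (sigma_compatible) => s0 spos ssym stri _ x y xy; apply: spos.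
apply/eqP; rewrite eq_le compatible_ge0 andbT leNgt; apply/negP => sxy.
have e0 : 0 < sigma x y / 2 by lra.
have [z [/= xz yz]] := xy _ _ (compatible_nbhs x e0) (compatible_nbhs y e0).
by have := stri x z y; rewrite [sigma z y]ssym; lra.
Qed.

End one_metric.

(** The conclusion is an eventual statement in [delta] so that finitely many maps can share one
    [delta]. *)
Lemma unif_continuous_on_compact (Y : pseudoMetricType R) (Z : topologicalType)
    (sigma : Z -> Z -> R) (f : Y -> Z) (K : set Y) :
  compatible_metric sigma -> continuous f -> compact K ->
  forall eps, 0 < eps -> \forall delta \near 0^'+,
    forall x y, K x -> ball x delta y -> sigma (f x) (f y) < eps.
Proof.
move=> scomp cf /compact_near_coveringP cK eps e0.
have e2 : 0 < eps / 2 by lra.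
case: (scomp) => _ _ ssym stri _.
suff H : \forall delta \near 0^'+,
    K `<=` (fun x => forall y, ball x delta y -> sigma (f x) (f y) < eps).
  by apply: filterS H => delta H x y /H; exact.
apply: (cK _ 0^'+ (fun delta x => forall y, ball x delta y -> sigma (f x) (f y) < eps)).
move=> x Kx; have /nbhs_ballP[r /= r0 rP] := cf x _ (compatible_nbhs scomp (f x) e2).
have r2 : 0 < r / 2 by lra.
exists (ball x (r / 2), [set d | d < r / 2]) => /=.
  by split; [exact: nbhsx_ballx|exact: nbhs_right_lt].
move=> [x' d] /= [xx' dr] y x'y.
have fx' : sigma (f x) (f x') < eps / 2 by apply: rP; apply: le_ball xx'; lra.
have fy : sigma (f x) (f y) < eps / 2.
  apply: rP; rewrite [r]splitr; apply: ball_triangle xx' _.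
  by apply: le_ball x'y; lra.
by have := stri (f x') (f x) (f y); rewrite [sigma (f x') (f x)]ssym; lra.
Qed.

(** Compactness of [Y * Y]: a pair at distance at least [eps] has images at some distance [c > 0],
    and the images of nearby pairs remain more than [c / 2] apart. *)
Lemma injective_continuous_unif_inverse (Y : metricType R) (Z : topologicalType)
    (sigma : Z -> Z -> R) (g : Y -> Z) :
  compatible_metric sigma -> continuous g -> injective g -> compact [set: Y] ->
  forall eps, 0 < eps -> exists2 delta, 0 < delta &
    forall x y, sigma (g x) (g y) < delta -> mdist x y < eps.
Proof.
move=> scomp cg ginj cY eps e0.
have /compact_near_coveringP cYY := compact_setX cY cY.
case: (scomp) => s0 spos ssym stri _.
have H : \forall delta \near 0^'+, [set: Y] `*` [set: Y] `<=`
    (fun p => sigma (g p.1) (g p.2) < delta -> mdist p.1 p.2 < eps).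
  apply: (cYY _ 0^'+ (fun delta (p : Y * Y) => sigma (g p.1) (g p.2) < delta -> mdist p.1 p.2 < eps)).
  move=> [x y] _ /=; have [xy|xy] := ltP (mdist x y) eps.
    have r0 : 0 < (eps - mdist x y) / 2 by lra.
    exists (ball x ((eps - mdist x y) / 2) `*` ball y ((eps - mdist x y) / 2), setT) => /=.
      split; last exact: filterT.
      by exists (ball x ((eps - mdist x y) / 2), ball y ((eps - mdist x y) / 2)) => //=;
        split; exact: nbhsx_ballx.
    move=> [[x' y'] d] /= [[+ +] _] _; rewrite !ballEmdist /= => xx' yy'.
    have := metric_triangle x x' y'; have := metric_triangle x' x y'.
    by have := metric_triangle x y y'; rewrite [mdist x' x]metric_sym; lra.
  have c0 : 0 < sigma (g x) (g y).
    rewrite lt_neqAle (compatible_ge0 scomp) andbT; apply/eqP => /esym/spos/ginj xy'.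
    by move: xy; rewrite xy' mdistxx; lra.
  set c := sigma (g x) (g y) in c0.
  have c4 : 0 < c / 4 by lra.
  exists ((g @^-1` [set w | sigma (g x) w < c / 4]) `*` (g @^-1` [set w | sigma (g y) w < c / 4]),
      [set d | d < c / 4]) => /=.
    split; last exact: nbhs_right_lt.
    exists (g @^-1` [set w | sigma (g x) w < c / 4], g @^-1` [set w | sigma (g y) w < c / 4]) => //=.
    by split; apply: cg; exact: compatible_nbhs.
  move=> [[x' y'] d] /= [[xx' yy'] dc] x'y'.
  have := stri (g x) (g x') (g y); have := stri (g x') (g y') (g y).
  by rewrite [sigma (g y') _]ssym -/c; lra.
have [d [d0 dP]] := filter_ex (filterI (nbhs_right_gt 0) H).
by exists d => // x y; exact: (dP (x, y)).
Qed.

End compatible_metrics.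

(** * Swelling a closed cover to functions without raising its order *)

Section swelling.
Context {R : realType} {X : metricType R}.

(** This is the positive part of [1 - dist(x, A) / d]; the value [0] also covers an empty [A]. *)
Definition tent (d : R) (A : set X) (x : X) : R :=
  sup [set v | v = 0 \/ exists2 y, A y & v = 1 - mdist x y / d].

Section tent.
Variables (d : R) (A : set X).
Hypothesis d0 : 0 < d.

Lemma tent_has_sup x :
  has_sup [set v | v = 0 \/ exists2 y, A y & v = 1 - mdist x y / d].
Proof.
split; first by exists 0; left.
exists 1 => _ [->//|[y _ ->]]; rewrite lerBlDr lerDl.
by rewrite divr_ge0 ?mdist_ge0// ltW.
Qed.

Lemma tent_ge0 x : 0 <= tent d A x.
Proof. by apply: ub_le_sup; [case: (tent_has_sup x)|left]. Qed.

Lemma tent_ge x y : A y -> 1 - mdist x y / d <= tent d A x.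
Proof. by move=> Ay; apply: ub_le_sup; [case: (tent_has_sup x)|right; exists y]. Qed.

Lemma tent_le1 x : tent d A x <= 1.
Proof.
apply: ge_sup; first by case: (tent_has_sup x).
move=> _ [->//|[y _ ->]]; rewrite lerBlDr lerDl.
by rewrite divr_ge0 ?mdist_ge0// ltW.
Qed.

Lemma tent_eq1 x : A x -> tent d A x = 1.
Proof.
by move=> /(tent_ge x); rewrite mdistxx mul0r subr0 => ?; apply/le_anti; rewrite tent_le1.
Qed.

Lemma tent_gt0 x : 0 < tent d A x -> exists2 y, A y & mdist x y < d.
Proof.
move=> /sup_adherent/(_ (tent_has_sup x))[_ [->|[y Ay ->]]]; rewrite subrr.
  by rewrite ltxx.
rewrite subr_gt0 ltr_pdivrMr// mul1r => ?.
by exists y.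
Qed.

Lemma tent_lipschitz x y : tent d A x <= tent d A y + mdist x y / d.
Proof.
have xyd : 0 <= mdist x y / d by rewrite divr_ge0 ?mdist_ge0// ltW.
apply: ge_sup; first by case: (tent_has_sup x).
move=> _ [->|[z Az ->]]; first by rewrite addr_ge0 ?tent_ge0.
have : mdist y z / d <= mdist x y / d + mdist x z / d.
  by rewrite -mulrDl ler_pM2r ?invr_gt0// [mdist x y]metric_sym metric_triangle.
by have := tent_ge y Az; lra.
Qed.

Lemma tent_continuous : continuous (tent d A).
Proof.
move=> x; apply/cvgrPdist_lt => e e0; apply/nbhs_ballP; exists (e * d) => /=.
  exact: mulr_gt0.
move=> y; rewrite ballEmdist /= -ltr_pdivrMr// => xy.
have := tent_lipschitz x y; have := tent_lipschitz y x.
by rewrite [mdist y x]metric_sym ltr_norml; lra.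
Qed.

End tent.

(** The members avoiding a point have closed union, so a ball around the point misses them. Finitely
    many half-size balls cover [X], and [y] is the centre of one containing [x]. *)
Lemma cover_neighborhoods (C : set (set X)) : compact [set: X] ->
  finite_set C -> (forall A, C A -> closed A) ->
  \forall d \near 0^'+, forall x : X, exists y, forall A, C A ->
    (exists2 a, A a & mdist x a < d) -> A y.
Proof.
move=> /compact_near_coveringP cX fC clC.
pose P (d : R) (x : X) := exists y, forall A, C A ->
    (exists2 a, A a & mdist x a < d) -> A y.
suff : \forall d \near 0^'+, [set: X] `<=` P d.
  by apply: filterS => d H x; exact: H.
apply: (cX _ 0^'+ P) => x _.
have [r r0 rP] : exists2 r : R, 0 < r & forall A, C A -> 
    (exists2 a, A a & mdist x a < r) -> A x.
  have : closed (\bigcup_(A in C `&` [set A | ~ A x]) A).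
    apply: closed_bigcup; first exact: finite_setIl.
    by move=> A [/clC].
  move=> /closed_openC oU.
  have /nbhs_ballP[r /= r0 rP] : nbhs x (~` (\bigcup_(A in C `&` [set A | ~ A x]) A)).
    by apply: open_nbhs_nbhs; split => // -[A [_]]; exact.
  exists r => // A CA [a Aa xa]; apply: contrapT => nAx.
  by apply: (rP a); [rewrite /= ballEmdist|exists A].
have r2 : 0 < r / 2 by lra.
exists (ball x (r / 2), [set d | d < r / 2]) => /=.
  by split; [exact: nbhsx_ballx|exact: nbhs_right_lt].
move=> [x' d] /= []; rewrite ballEmdist /= => xx' dr; exists x => A CA [a Aa x'a].
by apply: rP => //; exists a => //; have := metric_triangle x x' a; lra.
Qed.

(** The functions are tents of a small width [d]. Those positive at [x] belong to members within [d]
    of [x], and these members have a common point. *)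
Lemma swelling (C : set (set X)) (eta : R) : compact [set: X] ->
  finite_set C -> (forall A, C A -> closed A) -> \bigcup_(A in C) A = setT ->
  0 < eta -> exists (I : finType) (phi : I -> X -> R),
  [/\ forall i, continuous (phi i), forall i x, 0 <= phi i x <= 1,
      forall x, exists i, phi i x = 1,
      forall x, (#|[set i | (0 < phi i x)%R]%SET| <= ord C)%N &
      forall i, exists2 A, C A &
        forall x, 0 < phi i x -> exists2 y, A y & mdist x y < eta].
Proof.
move=> cX fC clC CT eta0.
have [d [[d0 deta] dP]] := filter_ex (filterI (filterI (nbhs_right_gt 0)
  (nbhs_right_lt eta0)) (cover_neighborhoods cX fC clC)).
have CI (i : fset_set C) : C (val i).
  by have := valP i; rewrite in_fset_set// inE.
exists (fset_set C : finType), (fun i => tent d (val i)); split.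
- by move=> i; exact: tent_continuous.
- by move=> i x; rewrite tent_ge0// tent_le1.
- move=> x; have [A CA Ax] : (\bigcup_(A in C) A) x by rewrite CT.
  have AC : A \in fset_set C by rewrite in_fset_set// inE.
  by exists [` AC]%fset; rewrite tent_eq1.
- move=> x; have [y yP] := dP x.
  set J := [set i | _]%SET.
  have -> : #|J| = #|` [fset val i | i in J]%fset|.
    by rewrite card_imfset ?cardE//; exact: val_inj.
  apply: (@ord_lb _ _ _ y) => // _ /imfsetP[i /= + ->]; rewrite inE => /(tent_gt0 d0) ix.
  by split; [exact: CI|apply: yP => //; exact: CI].
- move=> i; exists (val i) => // x /(tent_gt0 d0)[y iy xy].
  by exists y => //; exact: lt_trans deta.
Qed.

End swelling.

(** * Covers of [X] that stay small over a long range of times *)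

Section translations.
Context {R : realType} {X : metricType R}.
Variable a : action int X.

(* Either the order of a sufficiently fine cover is large, and then rounding the
   number of times costs little, or it is bounded, and then uniform continuity
   provides smallness for many times.  The times are negative in view of
   [borel_actionE]. *)
Lemma mdim_le_minus_slack (d d1 : R) : compact [set: X] -> 0 < d -> d < d1 ->
  mdim_le_minus (@mdist R X) a d -> forall eps, 0 < eps ->
  exists (C : set (set X)) (K : nat),
  [/\ finite_set C, forall A, C A -> closed A, \bigcup_(A in C) A = setT,
      (ord C)%:R <= d1 * K%:R :> R &
      forall A x y (z : int), C A -> A x -> A y -> 0 <= z <= K%:Z ->
        mdist (a x (- z)) (a y (- z)) < eps].
Proof.
move=> cX d0 dd1 aC eps e0.
suff [C [K [fC clC CT ordC small]]] : exists (C : set (set X)) (K : nat),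
    [/\ finite_set C, forall A, C A -> closed A, \bigcup_(A in C) A = setT,
        (ord C)%:R <= d1 * K%:R :> R &
        forall A x y (z : int), C A -> A x -> A y -> 0 <= z <= K%:Z ->
        mdist (a x z) (a y z) < eps].
  (* Pulling back by the translation by [- K] turns the times [0, ..., K] into [- K, ..., 0]. *)
  have aK : continuous (a^~ (- K%:Z)) by exact: act_continuous.
  have [fC' clC' CT'] := pullback_closed_cover aK fC clC CT.
  exists (pullback (a^~ (- K%:Z)) C), K; split => //.
    by apply: le_trans ordC; rewrite ler_nat ord_pullback.
  move=> _ x y z [A CA <-] /= Ax Ay zK.
  have -> : - z = - K%:Z + (K%:Z - z) by ring.
  by rewrite !(actD a _ (- K%:Z)); apply: (small A) => //; lia.
(* Rounding the number of times costs at most [d], which [(d1 - d) * K0] absorbs once the order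
   exceeds [d1 * K0]. *)
pose K0 := (Num.truncn (d / (d1 - d))).+1.
have K0P : d <= (d1 - d) * K0%:R.
  have d1d : 0 < d1 - d by lra.
  by rewrite mulrC -ler_pdivrMr// ltW// truncnS_gt.
have H : \forall delta \near 0^'+, forall i : 'I_K0.+1,
    forall x y, [set: X] x -> ball x delta y -> mdist (a x i%:Z) (a y i%:Z) < eps.
  apply: filter_forall => i; apply: unif_continuous_on_compact => //.
  - exact: mdist_compatible.
  - exact: act_continuous.
have [delta [d'0 dP]] := filter_ex (filterI (nbhs_right_gt 0) H).
have m0 : 0 < Num.min delta eps by rewrite lt_min d'0.
have [C [fC clC CT small]] := aC _ m0.
set n := ord C in small.
have [nK0|nK0] := leP n%:R (d1 * K0%:R : R).
  exists C, K0; split => // A x y z CA Ax Ay /andP[z0 zK0].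
  (* Smallness at time [0] is granted only for positive order; here [A] contains [x]. *)
  have n0 : (0 < n)%N.
    rewrite -(cardfs1 A); apply: (@ord_lb _ _ _ x) => // _ /fset1P ->.
    by split.
  have [k zE] : exists k : 'I_K0.+1, z = k%:Z.
    have zK : (`|z| < K0.+1)%N by lia.
    by exists (Ordinal zK) => /=; lia.
  rewrite zE; apply: dP => //; rewrite ballEmdist /=.
  have := small 0; rewrite mul0r lexx ltr0n n0 => /(_ isT).
  move=> /lt_mesh_translate/(_ CA Ax Ay); rewrite !act0 => xy.
  by apply: lt_le_trans xy _; rewrite ge_min lexx.
have n0 : 0 < n%:R :> R by apply: le_lt_trans nK0; apply: mulr_ge0 => //; lra.
have nd0 : 0 < n%:R / d by rewrite divr_gt0.
(* Writing the ceiling as [K + 1] makes [K] the last integer with [K * d < n]. *)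
have := ceil_itv (n%:R / d); have : 0 < Num.ceil (n%:R / d) by rewrite ceil_gt0.
case: (Num.ceil (n%:R / d)) => // -[//|K] _; rewrite intS addrAC subrr add0r.
rewrite ltr_pdivlMr// ler_pdivrMr// => /andP[Kn nK].
exists C, K; split => //.
  move: nK; rewrite rmorphD /= -[(Posz K)%:~R]/(K%:R) => nK.
  rewrite -/n -(ler_pM2l d0).
  have h1 : d1 * d <= d1 * ((d1 - d) * K0%:R) by rewrite ler_pM2l//; lra.
  have h2 : (d1 - d) * (d1 * K0%:R) <= (d1 - d) * n%:R.
    by rewrite ler_pM2l ?ltW// subr_gt0.
  have h3 : d1 * n%:R <= d1 * ((1 + K%:R) * d) by rewrite ler_pM2l//; lra.
  by lra.
move=> A x y z CA Ax Ay /andP[z0 zK].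
have zn : 0 <= z%:~R * d < n%:R.
  rewrite mulr_ge0 ?ler0z ?(ltW d0)//=; apply: le_lt_trans Kn.
  by rewrite ler_pM2r// ler_int.
apply: lt_le_trans (lt_mesh_translate (small z zn) CA Ax Ay) _.
by rewrite ge_min lexx orbT.
Qed.

End translations.

(** * The fibre over [0] and the bound of the mean dimension of [X] *)

Section borel_construction.
Context {R : realType} {X : metricType R}.
Variable a : action int X.

Local Notation q := (orbit_of (@diag_action R X a)).

Lemma borel_actionE x t (z : int) : borel_action R a (q (x, t)) z = q (a x (- z), t).
Proof.
rewrite (_ : borel_action _ _ _ _ = borel_flow R a (q (x, t)) z%:~R)//.
rewrite borel_flowE; apply/orbit_of_eqP; exists (- z).
by rewrite /= /diag_map /= rmorphN /= addrK.
Qed.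

Lemma borel_fiber_inj (t : R) : injective (fun x => q (x, t)).
Proof.
move=> x y /orbit_of_eqP[z] [-> /eqP].
by rewrite addrC -subr_eq subrr eq_sym intr_eq0 => /eqP ->; rewrite act0.
Qed.

Lemma borel_fiber_continuous (t : R) : continuous (fun x => q (x, t)).
Proof.
move=> x; apply: (@continuous_comp _ _ _ (fun x => (x, t)) q); last exact: orbit_of_continuous.
by apply: (@cvg_pair _ _ _ _ (nbhs x) (nbhs t)); [exact: cvg_id|exact: cvg_cst].
Qed.

Lemma mdim_le_minus_borel (rho : borel R a -> borel R a -> R) (d : R) :
  compact [set: X] -> compatible_metric rho -> 0 < d ->
  mdim_le_minus rho (borel_action R a) d -> mdim_le_minus (@mdist R X) a d.
Proof.
move=> cX rcomp d0 H eps e0.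
have e2 : 0 < eps / 2 by lra.
have [delta delta0 dP] := injective_continuous_unif_inverse rcomp
  (borel_fiber_continuous (t := 0)) (borel_fiber_inj (t := 0)) cX e2.
have [C [fC clC CT small]] := H _ delta0.
(* [N] is the last integer with [N * d < ord C]. Entering the fibre after translation by [N] makes
   time [z] on [X] correspond to time [N - z], which runs within [0, ..., N]. *)
pose N := Num.ceil ((ord C)%:R / d) - 1.
pose g x := q (a x N, 0 : R).
have cg : continuous g.
  move=> x; apply: (@continuous_comp _ _ _ (a^~ N) (fun x => q (x, 0))).
    exact: act_continuous.
  exact: borel_fiber_continuous.
have [fC' clC' CT'] := pullback_closed_cover cg fC clC CT.
exists (pullback g C); split => // z /andP[z0 zC].
apply: (@le_lt_trans _ _ (eps / 2)%:E); last by rewrite lte_fin; lra.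
apply: mesh_translate_le; first exact: ltW.
move=> _ x y [A CA <-] /= Ax Ay; apply: ltW; apply: dP.
have NE (w : X) : q (a w z, 0 : R) = borel_action R a (g w) (N - z).
  by rewrite borel_actionE -actD; congr (q (a w _, _)); ring.
rewrite !NE; apply: lt_mesh_translate CA Ax Ay; apply: small.
have zd : z%:~R < (ord C)%:R / d.
  rewrite ltr_pdivlMr//; apply: lt_le_trans zC _.
  by rewrite ler_nat ord_pullback.
have Nd : N%:~R * d < (ord C)%:R by rewrite -ltr_pdivlMr// ceilB1_lt.
have zN : z <= N by rewrite /N lerBrDr lezD1 -(ltr_int R); apply: lt_le_trans zd (ceil_ge _).
rewrite rmorphB /=; apply/andP; split.
  by rewrite mulr_ge0 ?subr_ge0 ?ler_int// ltW.
apply: le_lt_trans Nd; rewrite ler_pM2r// lerBlDr lerDl.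
move: z0; rewrite pmulr_lge0//.
Qed.

End borel_construction.

(** * A trapezoidal bump function on the line *)

Section bump.
Context {R : realType}.

Definition bump (M : nat) (s : R) : R :=
  Num.max 0 (Num.min 1 (Num.min (2 * s) (2 * (M.+1%:R - s)))).

Lemma bump_ge0 M s : 0 <= bump M s.
Proof. by rewrite /bump le_max lexx. Qed.

Lemma bump_eq1 M s : 1 / 2 <= s -> s <= M%:R + 1 / 2 -> bump M s = 1.
Proof.
move=> s1 sM; rewrite /bump (min_idPl _) ?(max_idPr _)//.
by rewrite le_min -[M.+1]addn1 natrD; apply/andP; split; lra.
Qed.

Lemma bump_gt0 M s : 0 < bump M s -> 0 < s < M.+1%:R.
Proof. by rewrite /bump lt_max ltxx /= !lt_min => /and3P[_ h1 h2]; apply/andP; split; lra. Qed.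

Lemma bump_continuous M : continuous (bump M).
Proof.
move=> s.
have c0 (c : R) : {for s, continuous (fun=> c : R)} by exact: cvg_cst.
have c1 : {for s, continuous (fun s : R => 2 * s)}.
  by apply: cvgM; [exact: cvg_cst|exact: cvg_id].
have c2 : {for s, continuous (fun s : R => 2 * (M.+1%:R - s))}.
  by apply: cvgM; [exact: cvg_cst|apply: cvgB; [exact: cvg_cst|exact: cvg_id]].
exact: (continuous_max (c0 0) (continuous_min (c0 1) (continuous_min c1 c2))).
Qed.

End bump.

(** * Level sets of the functions [Phi] on [X * R] *)

Section level_sets.
Context {R : realType} {X : metricType R}.
Variables (a : action int X) (I : finType) (phi : I -> X -> R).
Hypothesis phi_continuous : forall i, continuous (phi i).
Hypothesis phi01 : forall i x, 0 <= phi i x <= 1.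
Hypothesis phi_eq1 : forall x, exists i, phi i x = 1.
Variable n : nat.
Hypothesis phi_order : forall x, (#|[set i | (0 < phi i x)%R]%SET| <= n)%N.
Variables (M K : nat).
Hypothesis M_gt0 : (0 < M)%N.

Local Notation q := (orbit_of (@diag_action R X a)).

(* For [r = p M + j] this is [- j K - p]; the term [- p] makes [Phi_diag] hold. *)
Definition shift (r : int) : int := - ((r %% M)%Z * K%:Z) - (r %/ M)%Z.

Definition Phi (r : int) (i : I) (p : X * R) : R :=
  phi i (a p.1 (shift r)) * bump M (M%:R * p.2 - r%:~R).

Lemma shiftD (r z : int) : shift (r + z * M%:Z) = shift r - z.
Proof.
have M0 : M%:Z != 0 by lia.
by rewrite /shift [r + _]addrC modzMDl divzMDl//; ring.
Qed.

Lemma Phi_diag r i p z : Phi (r + z * M%:Z) i (diag_action a p z) = Phi r i p.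
Proof.
case: p => x t; rewrite /Phi /= shiftD -actD; congr (phi i (a x _) * bump M _).
  by ring.
by rewrite rmorphD rmorphM /= -[(Posz M)%:~R]/(M%:R : R); ring.
Qed.

Lemma Phi_gt0 r i p : 0 < Phi r i p ->
  0 < phi i (a p.1 (shift r)) /\ 0 < M%:R * p.2 - r%:~R < M.+1%:R.
Proof.
rewrite /Phi => H; have /andP[ph0 _] := phi01 i (a p.1 (shift r)).
have b0 := bump_ge0 M (M%:R * p.2 - r%:~R).
have ph : 0 < phi i (a p.1 (shift r)).
  by rewrite lt_neqAle ph0 andbT; apply/eqP => E; move: H; rewrite -E mul0r ltxx.
by split => //; apply: bump_gt0; move: H; rewrite pmulr_rgt0.
Qed.

Lemma Phi_continuous r i : continuous (Phi r i).
Proof.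
move=> p; apply: cvgM.
  apply: (@continuous_comp _ _ _ (fun p : X * R => a p.1 (shift r)) (phi i)).
    by apply: (@continuous_comp _ _ _ fst (a^~ (shift r))); [exact: cvg_fst|exact: act_continuous].
  exact: phi_continuous.
apply: (@continuous_comp _ _ _ (fun p : X * R => M%:R * p.2 - r%:~R) (bump M)).
  apply: cvgB; last exact: cvg_cst.
  by apply: cvgM; [exact: cvg_cst|exact: cvg_snd].
exact: bump_continuous.
Qed.

(* These M consecutive values of [r] represent all residues modulo [M]. *)
Lemma Phi_eq1 (p : X * R) : exists c : int, forall u : nat, (u < M)%N ->
  exists i, Phi (c - u%:Z) i p = 1.
Proof.
(* This is the largest [r] with [M * t - r >= 1 / 2]; lowering it by at most [M - 1] stays on the
   plateau of the bump. *)
case: p => x t; exists (Num.floor (M%:R * t - 1 / 2)) => u uM.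
set c := Num.floor _; have [i ix] := phi_eq1 (a x (shift (c - u%:Z))).
exists i; rewrite /Phi ix mul1r; have := floor_itv (M%:R * t - 1 / 2).
have uM' : u%:R + 1 <= M%:R :> R by rewrite natr1 ler_nat.
rewrite -/c rmorphD rmorphB /= -[(Posz u)%:~R]/(u%:R : R) => /andP[c1 c2].
by have u0 := ler0n R u; rewrite bump_eq1//; lra.
Qed.

(** The extra [1] in the denominator keeps the level of index [M.+1 * n] below [1]. *)
Definition level (k : nat) : R := k%:R / (M.+1 * n).+1%:R.

(** Forbidding values strictly between two consecutive levels makes the set closed, while each of
    its points still determines [P]. *)
Definition level_set (k : nat) (P : set (int * I)) : set (X * R) :=
  [set p | forall r i, (P (r, i) -> level k.+1 <= Phi r i p) /\
                       (~ P (r, i) -> Phi r i p <= level k)].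

Lemma level_lt k l : (k < l)%N -> level k < level l.
Proof. by move=> kl; rewrite /level ltr_pM2r ?invr_gt0 ?ltr0n// ltr_nat. Qed.

Lemma level_ge0 k : 0 <= level k.
Proof. by rewrite /level divr_ge0. Qed.

Lemma level_lt1 k : (k <= M.+1 * n)%N -> level k < 1.
Proof. by move=> km; rewrite /level ltr_pdivrMr ?ltr0n// mul1r ltr_nat. Qed.

Lemma level_set_memE k P p r i : level_set k P p ->
  P (r, i) <-> level k < Phi r i p.
Proof.
move=> /(_ r i)[Pge Ple]; split => [/Pge|kP].
  by apply: lt_le_trans; exact: level_lt.
by apply: contrapT => /Ple; rewrite leNgt kP.
Qed.

Lemma level_set_closed k P : closed (level_set k P).
Proof.
have -> : level_set k P = \bigcap_(ri in [set: int * I]) (Phi ri.1 ri.2 @^-1`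
    (if `[< P ri >] then [set v | level k.+1 <= v] else [set v | v <= level k])).
  apply/seteqP; split => [p pk [r i] _ /=|p pk r i].
    by case: asboolP => Pri /=; have [h1 h2] := pk r i; [exact: h1|exact: h2].
  by have := pk (r, i) Logic.I; case: asboolP => Pri /= h; split.
apply: closed_bigI => -[r i] _; apply: closed_comp.
  by move=> p _; exact: Phi_continuous.
by case: asboolP => _; [exact: closed_ge|exact: closed_le].
Qed.

(** If [z] takes [p] to [p'], then [P'] is [P] with indices shifted by [z * M], and [z] carries one
    level set into the other. By symmetry, images for the same [k] coincide or are disjoint. *)
Lemma level_set_image_sub k P P' p p' : level_set k P p -> level_set k P' p' ->
  q p = q p' -> q @` level_set k P `<=` q @` level_set k P'.
Proof.
move=> pP pP' /orbit_of_eqP[z p'E] _ [u uP <-].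
have PP' r i : P' (r, i) <-> P (r - z * M%:Z, i).
  rewrite (level_set_memE _ _ pP') (level_set_memE _ _ pP) p'E.
  by rewrite -{1}[r](subrK (z * M%:Z)) Phi_diag.
exists (diag_action a u z); last by apply/esym/orbit_of_eqP; exists z.
move=> r i; rewrite -{2 4}[r](subrK (z * M%:Z)) Phi_diag.
by rewrite !PP'; exact: uP.
Qed.

Lemma card_active (p : X * R) (c : int) :
  (#|[set ui : 'I_M.+1 * I | (0 < Phi (c - ui.1%:Z) ui.2 p)%R]%SET| <= M.+1 * n)%N.
Proof.
rewrite -sum1dep_card.
rewrite -(pair_big_dep xpredT (fun (u : 'I_M.+1) i => 0 < Phi (c - u%:Z) i p) (fun _ _ => 1%N)) /=.
rewrite -[M.+1 in leqRHS]card_ord -sum_nat_const; apply: leq_sum => u _.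
rewrite sum1dep_card; apply: leq_trans (phi_order (a p.1 (shift (c - u%:Z)))).
by apply/subset_leq_card/fintype.subsetP => i; rewrite !inE => /Phi_gt0[].
Qed.

(* Only [M.+1 * n] of the values [Phi r i p] are nonzero and one of them is [1],
   so they cannot meet all of the [M.+1 * n] level intervals. *)
Lemma level_gap (p : X * R) : exists2 k, (k < M.+1 * n)%N &
  level_set k [set ri | level k < Phi ri.1 ri.2 p] p.
Proof.
set m := (M.+1 * n)%N; apply: contrapT => nogap.
(* The largest integer below [M * p.2]: the active indices lie among [c, c - 1, ..., c - M]. *)
pose c := Num.ceil (M%:R * p.2) - 1.
have act r i : 0 < Phi r i p -> exists u : 'I_M.+1, r = c - u%:Z.
  move=> /Phi_gt0[_ /andP[r1 r2]].
  have := ceil_itv (M%:R * p.2); rewrite -/c => /andP[c1 c2].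
  have rc : r <= c.
    by rewrite /c lerBrDr lezD1 -(ltr_int R); apply: lt_le_trans c2; lra.
  have cM : c - r < M.+1%:Z.
    rewrite -(ltr_int R) rmorphB /=; apply: le_lt_trans r2.
    by rewrite lerB// ltW.
  have ub : (`|c - r| < M.+1)%N by lia.
  by exists (Ordinal ub) => /=; lia.
have /choice[f fP] (k : 'I_m.+1) : exists ui : 'I_M.+1 * I,
    level k < Phi (c - ui.1%:Z) ui.2 p /\
    ((k < m)%N -> Phi (c - ui.1%:Z) ui.2 p < level k.+1).
  have [km|mk] := ltnP k m.
    apply: contrapT => nok; apply: nogap; exists k => // r i /=.
    split=> // rik; last by rewrite leNgt; apply/negP.
    rewrite leNgt; apply/negP => rik'; apply: nok.
    have [u rE] := act r i (le_lt_trans (level_ge0 k) rik).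
    by exists (u, i) => /=; rewrite -rE.
  (* For [k = m] no gap is excluded; the value [1], above every level, serves instead. *)
  have [c' /(_ 0 M_gt0)[i Phi1]] := Phi_eq1 p.
  have [u rE] := act (c' - 0%:Z) i ltac:(by rewrite Phi1).
  exists (u, i) => /=; rewrite -rE Phi1; split => [|//].
  by apply: level_lt1; rewrite -ltnS.
have finj : injective f.
  suff H (k l : 'I_m.+1) : (k < l)%N -> f k <> f l.
    move=> k l fkl; apply: val_inj => /=.
    by have [/H/(_ fkl)|/H/(_ (esym fkl))|] := ltngtP k l.
  move=> kl fkl; have [_ fk] := fP k; have [fl _] := fP l.
  have km : (k < m)%N by apply: leq_trans kl _; rewrite -ltnS.
  move: (fk km); rewrite fkl ltNge => /negP; apply.
  apply: le_trans (ltW fl); rewrite /level ler_pM2r ?invr_gt0 ?ltr0n//.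
  by rewrite ler_nat.
have := leq_trans (_ : (m.+1 <= _)%N) (card_active p c).
rewrite -/m ltnn => /(_ _)/negP; apply => //.
rewrite -[m.+1]card_ord -cardsT -(card_imset _ finj).
apply/subset_leq_card/fintype.subsetP => _ /imsetP[k _ ->]; rewrite inE.
by have [+ _] := fP k; apply: le_lt_trans; exact: level_ge0.
Qed.


(** At times in [[0, 1)] only indices with [- M <= r < M] are active. Encoding them by a finite type
    makes the cover finite. *)
Definition window (T : {set 'I_(M + M) * I}) : set (int * I) :=
  [set ri | exists2 j : 'I_(M + M), ri.1 = j%:Z - M%:Z & (j, ri.2) \in T].

Lemma windowP T r i : window T (r, i) -> - M%:Z <= r < M%:Z.
Proof. by move=> [j /= -> _]; have := ltn_ord j; lia. Qed.

Lemma level_set_window (p : X * R) (k : nat) : 0 <= p.2 < 1 ->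
  exists T, [set ri | level k < Phi ri.1 ri.2 p] = window T.
Proof.
move=> /andP[t0 t1].
exists [set ji : 'I_(M + M) * I | (level k < Phi (ji.1%:Z - M%:Z) ji.2 p)%R]%SET.
apply/seteqP; split => -[r i] /=; last by move=> [j /= ->]; rewrite inE.
move=> kr; have := Phi_gt0 (le_lt_trans (level_ge0 k) kr) => -[_ /andP[r1 r2]].
have Mt0 : 0 <= M%:R * p.2 by rewrite mulr_ge0.
have Mt1 : M%:R * p.2 < M%:R by rewrite -[ltRHS]mulr1 ltr_pM2l// ltr0n.
have rM : r < M%:Z by rewrite -(ltr_int R); apply: le_lt_trans Mt1; lra.
have Mr : - M.+1%:Z < r.
  by rewrite -(ltr_int R) rmorphN /= -[(Posz M.+1)%:~R]/(M.+1%:R : R); lra.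
have ub : (`|(r + M%:Z)%R| < M + M)%N by lia.
have rE : r = (Ordinal ub)%:Z - M%:Z by move=> /=; lia.
by exists (Ordinal ub) => //=; rewrite inE /= -rE.
Qed.

Section small.
Variables (k : nat) (T : {set 'I_(M + M) * I}) (p p' : X * R).
Hypothesis km : (k < M.+1 * n)%N.
Hypothesis pT : level_set k (window T) p.
Hypothesis pT' : level_set k (window T) p'.

Lemma level_set_residues : exists c : int, forall u : nat, (u < M)%N ->
  exists i, window T (c - u%:Z, i).
Proof.
have [c cP] := Phi_eq1 p; exists c => u /cP[i Phi1]; exists i.
by apply/(level_set_memE _ _ pT); rewrite Phi1 level_lt1// ltnW.
Qed.

(** The window contains indices [c] and [c - (M - 1)]; activity at both confines [M * t] to
    [(c, c + 2)], for the same [c] at both points. *)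
Lemma level_set_time : -1 <= p.2 <= 2 /\ `|p.2 - p'.2| * M%:R < 2.
Proof.
have [c cP] := level_set_residues.
have M0 : 0 < M%:R :> R by rewrite ltr0n.
have H (p0 : X * R) : level_set k (window T) p0 -> c%:~R < M%:R * p0.2 < c%:~R + 2.
  move=> p0T; have [i ci] := cP 0 M_gt0.
  have M1 : (M.-1 < M)%N by rewrite prednK.
  have [i' ci'] := cP _ M1.
  have := (level_set_memE _ _ p0T).1 ci; have := (level_set_memE _ _ p0T).1 ci'.
  move=> /(le_lt_trans (level_ge0 _))/Phi_gt0[_ /andP[_ +]].
  move=> + /(le_lt_trans (level_ge0 _))/Phi_gt0[_ /andP[+ _]].
  rewrite !rmorphB /= -[(Posz M.-1)%:~R]/(M.-1%:R : R) -[(Posz 0)%:~R]/(0 : R).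
  have MR : M%:R = M.-1%:R + 1 :> R by rewrite natr1 prednK.
  rewrite -[M.+1]addn1 !natrD => h1 h2.
  by apply/andP; split; lra.
have [i /windowP/andP[cM Mc]] := cP 0 M_gt0.
have cM' : - M%:R <= c%:~R :> R.
  by rewrite -[M%:R]/((Posz M)%:~R : R) -rmorphN ler_int; lia.
have Mc' : c%:~R + 1 <= M%:R :> R.
  by rewrite -[M%:R]/((Posz M)%:~R : R) -(rmorphD _ c 1) ler_int; lia.
have /andP[a1 a2] := H _ pT; have /andP[b1 b2] := H _ pT'.
have M1 : 1 <= M%:R :> R by rewrite ler1n.
split; first by apply/andP; split; rewrite -(ler_pM2l M0); lra.
by rewrite -[M%:R]gtr0_norm// -normrM ltr_norml; apply/andP; split; lra.
Qed.

(** Division by [K] gives [z = j * K + rem]. An index of residue [j] in the window places both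
    points, translated by about [- j * K], in the support of one [phi i], which is small for the
    remaining time. *)
Lemma level_set_small (eps : R) :
  (forall i x y (z : int), 0 < phi i x -> 0 < phi i y -> 0 <= z <= K%:Z ->
    mdist (a x (- z)) (a y (- z)) < eps) ->
  forall z : int, 0 <= z < M%:Z * K%:Z ->
  mdist (a p.1 (- z)) (a p'.1 (- z)) < eps.
Proof.
move=> small z zMK.
have K_gt0 : (0 < K)%N by case: (posnP K) zMK => [->|//]; lia.
pose j := (z %/ K%:Z)%Z.
have jE : z = j * K%:Z + (z %% K%:Z)%Z by exact: divz_eq.
have rem0 : 0 <= (z %% K%:Z)%Z by apply: modz_ge0; lia.
have remK : (z %% K%:Z)%Z < K%:Z by apply: ltz_pmod; lia.
have j0 : 0 <= j by nia.
have jM : j < M%:Z by nia.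
have [c cP] := level_set_residues.
pose u := ((c - j) %% M%:Z)%Z.
have u0 : 0 <= u by apply: modz_ge0; lia.
have uM : u < M%:Z by apply: ltz_pmod; lia.
have uM' : (`|u| < M)%N by lia.
have [i ri] := cP _ uM'.
pose v := ((c - j) %/ M%:Z)%Z.
have cE : c - `|u|%:Z = j + v * M%:Z.
  have : c - j = v * M%:Z + u by exact: divz_eq.
  by lia.
have := windowP ri; rewrite cE => rM.
(* The remaining time is [rem - v], hence [rem] or [rem + 1]; the latter may equal [K], a time that
   [small] includes. *)
have v01 : v = 0 \/ v = -1 by nia.
have shE : shift (c - `|u|%:Z) = - (j * K%:Z) - v.
  by rewrite cE shiftD /shift modz_small ?divz_small ?subr0//; lia.
have pos (p0 : X * R) : level_set k (window T) p0 -> 0 < phi i (a p0.1 (- (j * K%:Z) - v)).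
  move=> p0T; rewrite -shE; have := (level_set_memE _ _ p0T).1 ri.
  by move=> /(le_lt_trans (level_ge0 _))/Phi_gt0[].
have -> : - z = (- (j * K%:Z) - v) - (z - j * K%:Z - v) by ring.
rewrite !(actD a _ (- (j * K%:Z) - v)); apply: small; [exact: pos|exact: pos|].
by case: v01 => ->; lia.
Qed.

End small.

End level_sets.

(** * The cover of Borel's construction and the equality *)

Section upper_bound.
Context {R : realType} {X : metricType R}.
Variable a : action int X.

Local Notation q := (orbit_of (@diag_action R X a)).

Lemma borel_repr (y : borel R a) : exists p : X * R, q p = y /\ 0 <= p.2 < 1.
Proof.
pose p := orbit_repr y.
exists (diag_action a p (- Num.floor p.2)); split.
  rewrite -[RHS]orbit_reprK; apply/orbit_of_eqP; exists (Num.floor p.2).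
  by rewrite -actD addNr act0.
have := floor_itv p.2; rewrite /= !rmorphD rmorphN /= => /andP[p1 p2].
by apply/andP; split; lra.
Qed.

Lemma borel_mdim_le_minus (rho : borel R a -> borel R a -> R) (d d' : R) :
  compact [set: X] -> compatible_metric rho -> 0 < d -> d < d' ->
  mdim_le_minus (@mdist R X) a d -> mdim_le_minus rho (borel_action R a) d'.
Proof.
move=> cX rcomp d0 dd' H eps eps0.
pose d1 := (d + d') / 2.
have dd1 : d < d1 by rewrite /d1; lra.
have d1d' : d1 < d' by rewrite /d1; lra.
have e2 : 0 < eps / 2 by lra.
have cXI : compact ([set: X] `*` `[-1, 2 : R]%classic).
  by apply: compact_setX => //; exact: segment_compact.
have [delta [delta0 deltaP]] := filter_ex (filterI (nbhs_right_gt 0)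
  (unif_continuous_on_compact rcomp (orbit_of_continuous (b := diag_action a)) cXI e2)).
(* The first term makes the time spread [2 / M] less than [delta]; the second gives
   [(M + 1) * d1 <= M * d']. *)
have [M M_gt0 MP] : exists2 M, (0 < M)%N & 2 / delta + d1 / (d' - d1) < M%:R.
  by exists (Num.truncn (2 / delta + d1 / (d' - d1))).+1 => //; exact: truncnS_gt.
have c1 : 0 < 2 / delta by rewrite divr_gt0.
have c2 : 0 < d1 / (d' - d1) by rewrite divr_gt0//; lra.
have Mdelta : 2 < delta * M%:R.
  by rewrite mulrC -ltr_pdivrMr//; lra.
have Md : M.+1%:R * d1 <= M%:R * d'.
  have : d1 < M%:R * (d' - d1) by rewrite -ltr_pdivrMr; lra.
  by rewrite -addn1 natrD; lra.
(* One third for the member of the cover and one for each of the two moves from the support of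
   [phi i] to it. *)
have delta3 : 0 < delta / 3 by lra.
have [C [K [fC clC CT ordC small]]] := mdim_le_minus_slack cX d0 dd1 H delta3.
have Heta : \forall eta \near 0^'+, forall z : 'I_K.+1,
    forall x y, [set: X] x -> ball x eta y ->
      mdist (a x (- z%:Z)) (a y (- z%:Z)) < delta / 3.
  apply: filter_forall => z; apply: unif_continuous_on_compact => //.
  - exact: mdist_compatible.
  - exact: act_continuous.
have [eta [eta0 etaP]] := filter_ex (filterI (nbhs_right_gt 0) Heta).
have [I [phi [phi_cont phi01 phi1 phi_ord phi_small]]] := swelling cX fC clC CT eta0.
have phiK i x y (z : int) : 0 < phi i x -> 0 < phi i y -> 0 <= z <= K%:Z ->
    mdist (a x (- z)) (a y (- z)) < delta.
  have [A CA iA] := phi_small i; move=> /iA[x' Ax' xx'] /iA[y' Ay' yy'] zK.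
  have near w w' : mdist w w' < eta -> mdist (a w (- z)) (a w' (- z)) < delta / 3.
    have [zb ->] : exists zb : 'I_K.+1, z = zb%:Z.
      case: z zK => // z zK.
      by have zb : (z < K.+1)%N by []; exists (Ordinal zb).
    by move=> ww'; apply: etaP; rewrite // ballEmdist.
  have h1 := near _ _ xx'; have h2 := near _ _ yy'.
  have h3 := small _ _ _ _ CA Ax' Ay' zK.
  have := metric_triangle (a x (- z)) (a x' (- z)) (a y (- z)).
  have := metric_triangle (a x' (- z)) (a y' (- z)) (a y (- z)).
  by rewrite [mdist (a y' _) (a y _)]metric_sym; lra.
set n := ord C in phi_ord ordC; pose m := (M.+1 * n)%N.
pose E (k : nat) (T : {set 'I_(M + M) * I}) : set (X * R) :=
  level_set a phi n M K k (window T).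
pose D := [set q @` E kT.1 kT.2 | kT in [set: 'I_m * {set 'I_(M + M) * I}]].
have fD : finite_set D by apply: finite_image; exact: finite_finset.
have E_time k T : (k < m)%N -> E k T `<=` [set: X] `*` `[-1, 2 : R]%classic.
  move=> km p pE; split => //=; rewrite in_itv /=.
  by have [] := level_set_time phi01 phi1 M_gt0 km pE pE.
have DE (k : 'I_m) (T : {set 'I_(M + M) * I}) p p' (z : int) :
    0 <= z < M%:Z * K%:Z -> E k T p -> E k T p' ->
    rho (borel_action R a (q p) z) (borel_action R a (q p') z) <= eps / 2.
  case: p p' => x t [x' t'] zMK pE pE'.
  rewrite !borel_actionE; apply: ltW; apply: deltaP; first last.
    split => /=; last first.
      have [_] := level_set_time phi01 phi1 M_gt0 (ltn_ord k) pE pE'.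
      move=> /= tt'; rewrite /ball /= -(ltr_pM2r (_ : 0 < M%:R :> R)) ?ltr0n//.
      exact: lt_trans Mdelta.
    rewrite ballEmdist /=.
    exact: (level_set_small phi01 phi1 M_gt0 (ltn_ord k) pE pE' phiK).
  by have [_ /=] := E_time _ _ (ltn_ord k) _ pE.
exists D; split => //.
(* The level set is closed in [X * [-1, 2]], so its image is compact in a Hausdorff space. *)
- move=> _ [[k T] _ <-]; apply: compact_closed; first exact: compatible_hausdorff rcomp.
  apply: continuous_compact.
    by apply: continuous_subspaceT; exact: orbit_of_continuous.
  apply: subclosed_compact cXI (E_time _ _ (ltn_ord k)).
  exact: level_set_closed.
- rewrite -subTset => y _; have [p [<- p01]] := borel_repr y.
  have [k km gap] := level_gap a phi01 phi1 phi_ord K M_gt0 p.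
  have [T TE] := level_set_window a phi01 n K M_gt0 k p01.
  exists (q @` E k T); first by exists (Ordinal km, T).
  by exists p => //; rewrite /E -TE.
have ordD : (ord D <= m)%N.
  apply: (@ord_disjoint_families _ _ _ (fun k => [set q @` E k T | T in setT])) => //.
    by move=> _ [[k T] _ <-]; exists k, T.
  move=> k _ _ _ [T _ <-] [T' _ <-] [p pE <-] [p' pE' qq].
  have sub := @level_set_image_sub _ _ a I phi n M K M_gt0 k.
  by apply/seteqP; split; [exact: sub pE pE' (esym qq)|exact: sub pE' pE qq].
move=> z /andP[z0 zD].
apply: (@le_lt_trans _ _ (eps / 2)%:E); last by rewrite lte_fin; lra.
apply: mesh_translate_le; first exact: ltW.
move=> _ _ _ [[k T] _ <-] [p pE <-] [p' pE' <-]; apply: (DE k T) => //.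
have d'0 : 0 < d' by lra.
have zz0 : 0 <= z by rewrite -(ler0z R) -(pmulr_lge0 _ d'0).
rewrite zz0 /= -(ltr_int R) rmorphM /= -(ltr_pM2r d'0); apply: lt_le_trans zD _.
(* The chain [ord D <= (M + 1) * n <= (M + 1) * d1 * K <= M * d' * K] bounds [z] by [M * K]. *)
apply: (@le_trans _ _ (M.+1%:R * n%:R)); first by rewrite -natrM ler_nat.
apply: (@le_trans _ _ (M.+1%:R * (d1 * K%:R))); first by rewrite ler_pM2l.
rewrite mulrA; apply: (@le_trans _ _ (M%:R * d' * K%:R)); last by rewrite mulrAC.
by rewrite ler_wpM2r.
Qed.

End upper_bound.

Theorem theorem1p2 (R : realType) (X : metricType R)
    (X_compact : compact [set: X]) (a : action int X)
    (rho : borel R a -> borel R a -> R) (rho_compatible : compatible_metric rho) :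
  mdim rho (borel_action R a) = mdim (@mdist R X) a.
Proof.
apply/eqP; rewrite eq_le; apply/andP; split.
  (* An admissible [d] for [X] makes every [d + e] admissible for Borel's construction; in the other
     direction [d] itself remains admissible. *)
  apply: le_ereal_inf_tmp => _ [d [d0 dX] <-].
  apply/lee_addgt0Pr => e e0; apply: ereal_inf_lbound.
  exists (d + e) => //; split; first exact: addr_gt0.
  by apply: (borel_mdim_le_minus X_compact rho_compatible d0 _ dX); lra.
apply: le_ereal_inf => _ [d [d0 dW] <-]; exists d => //; split => //.
exact: mdim_le_minus_borel dW.
Qed.
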